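(* Consider a structured problem in the class $\mathcal{SP}(m_f,\sigma_f,\bar\sigma_f,L,\delta)$. Assume additionally that $L(\cdot)=L\ge0$ and $\delta(\cdot,\cdot)=\delta\ge0$ are constant, and that $L\ge\bar\sigma_f\sigma_d$. (i) Let $\{(z_{k-1},w_{k-1},x_k,\hat x_k)\}_{k\ge0}$ be generated by the modified method of Method S with $$\beta_k\equiv\frac{L-\bar\sigma_f\sigma_d}{\sigma_d},\qquad\lambda_0=1,\qquad(L-\bar\sigma_f\sigma_d)\lambda_{k+1}^2=\sigma_d(S_k\sigma_f+\beta_{k-1})(\lambda_{k+1}+S_k)\ (k\ge0),$$ i.e., $\lambda_{k+1}$ is determined as the largest root of this quadratic equation. Then for every $k\ge0$ $$f(\hat x_k)-f(x^* )+\sigma_f\xi(z_k,x^* )\le\frac{L-\bar\sigma_f\sigma_d}{\sigma_d}l_d(z_k;x^* )\min\left\{\frac4{(k+2)^2},\left(1+\frac12\sqrt{\frac{\sigma_f\sigma_d}{L-\bar\sigma_f\sigma_d}}\right)^{-2k}\right\}$$ $$\qquad\qquad+\min\left\{\frac13k+\frac16\log(k+2)+1,\ 1+\sqrt{\frac{L-\bar\sigma_f\sigma_d}{\sigma_f\sigma_d}}\right\}\delta,$$ where the second entry of the last minimum is read as $+\infty$ if $\sigma_f=0$. (ii) Suppose further that $\sigma_f=0$ and $Q$ is bounded. Let $\{(z_{k-1},w_{k-1},x_k,\hat x_k)\}_{k\ge0}$ be generated by the modified method of Method S with $\beta_k\equiv0$ and $\lambda_k:=(k+1)/2$ (a conditional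 gradient method). Then for every $k\ge0$ $$f(\hat x_k)-f(x^* )\le\frac{2L\max_{0\le i\le k}\|w_i-z_{i-1}\|^2}{k+4}+\frac{k+3}3\delta.$$
   Context: Setting. $E$ is a finite-dimensional real normed space with norm $\|\cdot\|$; $E^*$ is its dual, with pairing $\langle s,x\rangle$. $Q\subset E$ is a closed convex set and $f:E\to\mathbb R\cup\{+\infty\}$ is a lower-semicontinuous (lsc) convex function with $Q\subset \mathrm{dom} f$. The problem $\min_{x\in Q}f(x)$ is assumed to have an optimal solution; $x^*\in Q$ denotes one. A prox-function $d:E\to\mathbb R\cup\{+\infty\}$ is fixed: $d$ is nonnegative, continuously differentiable and strongly convex on $Q$ ($Q\subset\mathrm{dom}\,d$) with constant $\sigma_d>0$ with respect to $\|\cdot\|$, and $d(x_0)=\min_{x\in Q}d(x)=0$ for its unique minimizer $x_0\in Q$. For $x,y\in Q$: $l_d(y;x):=d(y)+\langle\nabla d(y),x-y\rangle$ and $\xi(y,x):=d(x)-l_d(y;x)$ (Bregman distance). For an lsc convex $\psi:E\to\mathbb R\cup\{+\infty\}$ with $Q\subset\mathrm{dom}\,\psi$, $\sigma(\psi):=\{\tau\ge0:\psi(x)-\tau d(x)\text{ is an lsc convex function on }Q\}$. Class $\mathcal{SP}(m_f,\sigma_f,\bar\sigma_f,L,\delta)$: problems $\min_{x\in Q}f(x)$ for which the following are given. For each $y\in Q$, $m_f(y;\cdot):E\to\mathbb R\cup\{+\infty\}$ is an lsc convex function with $m_f(y;x)\le f(x)$ for all $x\in Q$; $\sigma_f\ge0$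 satisfies $\sigma_f\in\sigma(f)\cap\bigcap_{y\in Q}\sigma(m_f(y;\cdot))$; $\bar\sigma_f\in[0,\sigma_f]$; $L(\cdot)\ge0$ is a function on $Q$; $\delta(y,\cdot)$ is a nonnegative convex function on $Q$ for each $y\in Q$; and $$f(x)\le[m_f(y;x)-\bar\sigma_f\xi(y,x)]+\tfrac{L(y)}2\|y-x\|^2+\delta(y,x)\quad\forall x,y\in Q.$$ Subproblems $\min_{x\in Q}\{m_f(y;x)+\langle s,x\rangle+\beta d(x)\}$ ($\beta\ge0$, $y\in Q$, $s\in E^*$) are assumed efficiently solvable ($Q$ is additionally assumed bounded when $\beta=0$ and $\sigma_f=0$, to ensure existence of a solution). Parameters. Weight parameters $\lambda_k>0$ ($k\ge0$); scaling parameters $\beta_k\ge0$ ($k\ge-1$), nondecreasing in $k$. $S_k:=\sum_{i=0}^k\lambda_i$, $S_{-1}:=0$. Property 2 for a coupled sequence of functions $\{(\varphi_k(x),\psi_k(x))\}_{k\ge-1}$ (associated with $\{\lambda_k\},\{\beta_k\}$ and test points $\{x_k\}_{k\ge0}$), with $z_k:=\mathrm{argmin}_{x\in Q}\varphi_k(x)$, $w_k:=\mathrm{argmin}_{x\in Q}\psi_k(x)$: (B0) $\varphi_k(x)\ge\psi_k(x)$ for all $x\in Q$. (B1) $\psi_{-1}(w_{-1})=0$ and $z_{-1}=w_{-1}=x_0$. (B2) For all $k\ge-1$, $x\in Q$: $\psi_{k+1}(x)\ge\varphi_k(z_k)+\lambda_{k+1}m_f(x_{k+1};x)+\beta_{k+1}d(x)-\beta_kl_d(z_k;x)+S_k\sigma_f\xi(z_k,x)$.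 (B3) For all $k\ge-1$: $\psi_k(w_k)\le\min_{x\in Q}\{\sum_{i=0}^k\lambda_im_f(x_i;x)+\beta_kl_d(z_k;x)-S_k\sigma_f\xi(z_k,x)\}$. Method S, modified variant. With a coupled sequence $\{(\varphi_k,\psi_k)\}_{k\ge-1}$ satisfying Property 2: set $x_0:=z_{-1}:=w_{-1}:=\mathrm{argmin}_{x\in Q}d(x)$, $z_0:=\mathrm{argmin}_{x\in Q}\varphi_0(x)$, $\hat x_0:=w_0:=\mathrm{argmin}_{x\in Q}\psi_0(x)$. For $k\ge0$ set $x_{k+1}:=\frac{S_k\hat x_k+\lambda_{k+1}z_k}{S_{k+1}}$, $z_{k+1}:=\mathrm{argmin}_{x\in Q}\varphi_{k+1}(x)$, $w_{k+1}:=\mathrm{argmin}_{x\in Q}\psi_{k+1}(x)$, $\hat x_{k+1}:=\frac{S_k\hat x_k+\lambda_{k+1}w_{k+1}}{S_{k+1}}$.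
   Formalization: In (i) the printed inequality can fail when l_d(z_k;x* )<0 and δ>0; it is proved as printed when l_d(z_k;x* )≥0 or δ=0, and otherwise with l_d(z_k;x* ) replaced by max{l_d(z_k;x* ),0}. *)

(* Defs.v *)
From HB Require Import structures.
From mathcomp Require Import all_boot all_order all_algebra.
From mathcomp Require Import all_classical all_reals all_analysis.

Set Implicit Arguments.
Unset Strict Implicit.
Unset Printing Implicit Defensive.

Import Order.TTheory GRing.Theory Num.Theory.
Import numFieldNormedType.Exports.

Local Open Scope classical_set_scope.
Local Open Scope ring_scope.

Definition finite_dimensional (R : realType) (E : normedModType R) : Prop :=
  exists (n : nat) (e : 'I_n -> E),
    forall v : E, exists c : 'I_n -> R, v = \sum_(i < n) c i *: e i.

Section ConvexFunctions.
Context {R : realType} {E : normedModType R}.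
Implicit Types (A Q : set E) (g psi : E -> \bar R).

(* Functions E -> R \cup {+oo} are functions to [\bar R] omitting -oo. *)
Definition nowhere_ninfty g : Prop := forall x, (-oo < g x)%E.

Definition effective_domain g : set E := [set x | (g x < +oo)%E].

Definition convex_on A g : Prop :=
  forall x y (t : R), A x -> A y -> 0 <= t <= 1 ->
    (g (t *: x + (1 - t) *: y)%R <= t%:E * g x + (1 - t)%:E * g y)%E.

(* Lower semicontinuity is relative to A: neighbourhoods are those of the
   subspace topology of A. *)
Definition lsc_convex_on A g : Prop :=
  lower_semicontinuous (g : subspace A -> \bar R) /\ convex_on A g.

Definition strongly_convex_on A (sigma : R) g : Prop :=
  forall x y (t : R), A x -> A y -> 0 <= t <= 1 ->
    (g (t *: x + (1 - t) *: y)%R <=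
     t%:E * g x + (1 - t)%:E * g y
     - (sigma / 2 * (t * (1 - t)) * `|x - y| ^+ 2)%:E)%E.

Definition argmin Q g : set E :=
  [set z | Q z /\ forall x, Q x -> (g z <= g x)%E].

(* [gd y] is the gradient of [d] at [y], an element of the dual of [E] (every
   linear form on a finite-dimensional space is continuous).  Q may have empty
   interior and [d] may be +oo outside Q, so differentiability at a point of Q
   is along Q.  Then [gd y] need not be unique, but [gd y (x - y)] is
   determined by [d] for all x, y in Q, since Q is convex.  The second
   definition is continuity on Q for the dual norm. *)
Definition gradient_on Q (d : E -> \bar R) (gd : E -> {scalar E}) : Prop :=
  forall y, Q y -> forall eps : R, 0 < eps ->
    \forall x \near y, Q x ->
      `|fine (d x) - fine (d y) - gd y (x - y)| <= eps * `|x - y|.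

Definition continuous_gradient_on Q (gd : E -> {scalar E}) : Prop :=
  forall y, Q y -> forall eps : R, 0 < eps ->
    \forall x \near y, Q x ->
      forall v : E, `|gd x v - gd y v| <= eps * `|v|.

Record prox_function Q (d : E -> \bar R) (gd : E -> {scalar E})
    (sd : R) (x0 : E) : Prop := ProxFunction {
  prox_ninfty : nowhere_ninfty d;
  prox_dom : Q `<=` effective_domain d;
  prox_ge0 : forall x, Q x -> (0 <= d x)%E;
  prox_gradient : gradient_on Q d gd;
  prox_C1 : continuous_gradient_on Q gd;
  prox_sd_gt0 : 0 < sd;
  prox_strongly_convex : strongly_convex_on Q sd d;
  prox_center : argmin Q d = [set x0];
  prox_center0 : d x0 = 0%E
}.

(* l_d(y; x) and the Bregman distance xi(y, x); [fine] is harmless, as both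
   are only used at points of Q, where [d] is finite. *)
Definition linearization (d : E -> \bar R) (gd : E -> {scalar E})
    (y x : E) : R := fine (d y) + gd y (x - y).

Definition bregman (d : E -> \bar R) (gd : E -> {scalar E}) (y x : E) : R :=
  fine (d x) - linearization d gd y x.

Definition convexity_params Q (d : E -> \bar R) psi : set R :=
  [set tau | 0 <= tau /\
     lsc_convex_on Q (fun x => psi x - tau%:E * d x)%E].

End ConvexFunctions.

Section Method.
Context {R : realType} {E : normedModType R}.
Variables (Q : set E) (d : E -> \bar R) (gd : E -> {scalar E}).

Local Notation l_d := (linearization d gd).
Local Notation xi := (bregman d gd).

Record structured_problem (f : E -> \bar R) (mf : E -> E -> \bar R)
    (sf sbar : R) (L : E -> R) (delta : E -> E -> R) : Prop :=
  StructuredProblem {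
  sp_f_ninfty : nowhere_ninfty f;
  sp_f_lsc : lower_semicontinuous f;
  sp_f_convex : convex_on setT f;
  sp_f_dom : Q `<=` effective_domain f;
  sp_m_ninfty : forall y, Q y -> nowhere_ninfty (mf y);
  sp_m_lsc : forall y, Q y -> lower_semicontinuous (mf y);
  sp_m_convex : forall y, Q y -> convex_on setT (mf y);
  sp_m_le : forall y x, Q y -> Q x -> (mf y x <= f x)%E;
  sp_sf_ge0 : 0 <= sf;
  sp_sf_f : convexity_params Q d f sf;
  sp_sf_m : forall y, Q y -> convexity_params Q d (mf y) sf;
  sp_sbar : 0 <= sbar <= sf;
  sp_L_ge0 : forall y, Q y -> 0 <= L y;
  sp_delta_ge0 : forall y x, Q y -> Q x -> 0 <= delta y x;
  sp_delta_convex : forall y, Q y -> convex_function Q (delta y);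
  sp_upper : forall x y, Q x -> Q y ->
    (f x <= (mf y x - (sbar * xi y x)%:E)
            + (L y / 2 * `|y - x| ^+ 2)%:E + (delta y x)%:E)%E
}.

(* Index convention: the sequences that start at k = -1 are shifted by one, so
   [beta j], [phi j], [psi j], [z j], [w j] stand for beta_{j-1}, phi_{j-1},
   psi_{j-1}, z_{j-1}, w_{j-1}, and [psum lam j] for S_{j-1}; in particular
   S_{-1} = 0.  The sequences [lam], [x], [xh] start at k = 0, unshifted. *)
Definition psum (lam : nat -> R) (j : nat) : R := \sum_(i < j) lam i.

Record weight_parameters (lam beta : nat -> R) : Prop := WeightParameters {
  lam_gt0 : forall k, 0 < lam k;
  beta_ge0 : forall j, 0 <= beta j;
  beta_nondecreasing : nondecreasing_seq beta
}.

(* In [cs_B2] and [cs_B3] the paper's k is j - 1. *)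
Record coupled_sequence (mf : E -> E -> \bar R) (sf : R) (x0 : E)
    (lam beta : nat -> R) (x : nat -> E)
    (phi psi : nat -> E -> \bar R) (z w : nat -> E) : Prop := CoupledSequence {
  cs_phi_ninfty : forall j, nowhere_ninfty (phi j);
  cs_psi_ninfty : forall j, nowhere_ninfty (psi j);
  cs_z : forall j, argmin Q (phi j) (z j);
  cs_w : forall j, argmin Q (psi j) (w j);
  cs_B0 : forall j y, Q y -> (psi j y <= phi j y)%E;
  cs_B1_psi : psi 0%N (w 0%N) = 0%E;
  cs_B1_z : z 0%N = x0;
  cs_B1_w : w 0%N = x0;
  cs_B2 : forall j y, Q y ->
    (phi j (z j) + (lam j)%:E * mf (x j) y + (beta j.+1)%:E * d y
       - (beta j * l_d (z j) y)%:E + (psum lam j * sf * xi (z j) y)%:E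
     <= psi j.+1 y)%E;
  cs_B3 : forall j,
    (psi j (w j) <=
     ereal_inf [set (\sum_(i < j) (lam i)%:E * mf (x i) y
                     + (beta j * l_d (z j) y)%:E
                     - (psum lam j * sf * xi (z j) y)%:E) | y in Q])%E
}.

(* That z_k and w_k minimize phi_k and psi_k over Q, and that
   z_{-1} = w_{-1} = x0, is part of [coupled_sequence]. *)
Record modified_method (mf : E -> E -> \bar R) (sf : R) (x0 : E)
    (lam beta : nat -> R) (phi psi : nat -> E -> \bar R)
    (z w x xh : nat -> E) : Prop := ModifiedMethod {
  mm_parameters : weight_parameters lam beta;
  mm_coupled_sequence : coupled_sequence mf sf x0 lam beta x phi psi z w;
  mm_x0 : x 0%N = x0;
  mm_xh0 : xh 0%N = w 1%N;
  mm_x : forall k, x k.+1 =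
    (psum lam k.+2)^-1 *: (psum lam k.+1 *: xh k + lam k.+1 *: z k.+1);
  mm_xh : forall k, xh k.+1 =
    (psum lam k.+2)^-1 *: (psum lam k.+1 *: xh k + lam k.+1 *: w k.+2)
}.

End Method.

Definition largest_root (R : realType) (eqn : R -> Prop) (r : R) : Prop :=
  eqn r /\ forall mu, eqn mu -> mu <= r.

(* Below, [M] is L - sbar * sd; when sf = 0 the second entry of the minimum in
   [error_factor] is +oo. *)
Definition rate (R : realType) (M sf sd : R) (k : nat) : R :=
  Num.min (4 / (k%:R + 2) ^+ 2)
          ((1 + 2^-1 * Num.sqrt (sf * sd / M)) ^- (2 * k)).

Definition error_factor (R : realType) (M sf sd : R) (k : nat) : R :=
  let growth := 3^-1 * k%:R + 6^-1 * ln (k%:R + 2) + 1 in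
  if sf == 0 then growth
  else Num.min growth (1 + Num.sqrt (M / (sf * sd))).

(* Main.v *)
Require Import Defs.
From mathcomp Require Import all_boot all_order all_algebra.
From mathcomp Require Import all_classical all_reals all_analysis.
From mathcomp Require Import ring lra.

Import Order.TTheory GRing.Theory Num.Theory.
Import numFieldNormedType.Exports.

Local Open Scope classical_set_scope.
Local Open Scope ring_scope.

(* With S_k the partial sums of the weights, one shows by induction
     S_k f(hat x_k) <= psi_k(w_k) + sum of step errors.
   In the inductive step (B2) is evaluated at w_{k+1}; convexity of the model
   combines its values at hat x_k and w_{k+1} into the one at hat x_{k+1}, and
   since hat x_{k+1} - x_{k+1} = (lambda_{k+1} / S_{k+1}) (w_{k+1} - z_k), the
   quadratic part of the upper model is absorbed by the Bregman term
   (beta_k + S_k sigma_f) xi(z_k, w_{k+1}); the equation for lambda_{k+1} makes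
   the two cancel exactly.  Then (B3) at x^* bounds psi_k(w_k).  What remains
   is the growth of S_k, read off from sqrt S_{k+1} - sqrt S_k, and of the
   error (S_0 + ... + S_k) / S_k. *)

(** * Growth of the total weights and of the error coefficient *)

Lemma ln_succ_ge {R : realType} (n : R) : 0 < n -> (n + 1)^-1 <= ln (n + 1) - ln n.
Proof.
move=> n0; have n1 : 0 < n + 1 by lra.
rewrite -[_ - _]opprB -ln_div ?posrE//.
have -> : n / (n + 1) = 1 + - (n + 1)^-1 by field; rewrite gt_eqF.
rewrite lerNr; apply: le_ln1Dx.
by rewrite ltrN2 invf_lt1//; lra.
Qed.

Definition error_ratio {R : realType} (A : nat -> R) (k : nat) : R :=
  (\sum_(i < k.+1) A i) / A k.

Section StepSizes.
Context {R : realType}.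
(** [A k] stands for S_k, unshifted, and [q] for sigma_f sigma_d / M; [lamE] is the root equation
    for the weights divided by M. *)
Context {q : R} {lam A : nat -> R}.
Hypotheses (q_ge0 : 0 <= q) (lam_gt0 : forall k, 0 < lam k).
Hypotheses (lam0 : lam 0%N = 1) (A0 : A 0%N = 1).
Hypothesis AS : forall k, A k.+1 = A k + lam k.+1.
Hypothesis lamE : forall k, lam k.+1 ^+ 2 = (1 + q * A k) * A k.+1.

Lemma total_weight_gt0 k : 0 < A k.
Proof. by elim: k => [|k IH]; rewrite ?A0 // AS addr_gt0. Qed.

(** With u, v the square roots of A_k, A_{k+1}: lam_{k+1} = (v - u)(v + u) <= 2 v (v - u), while
    [lamE] gives lam_{k+1} >= c v. The choice c = 1 yields quadratic growth, c = sqrt (q A_k)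
    geometric growth. *)
Lemma sqrt_total_weight_step k (c : R) : 0 <= c -> c ^+ 2 <= 1 + q * A k ->
  Num.sqrt (A k) + c / 2 <= Num.sqrt (A k.+1).
Proof.
move=> c0 hc; set u := Num.sqrt (A k); set v := Num.sqrt (A k.+1).
have u0 : 0 < u by rewrite sqrtr_gt0 total_weight_gt0.
have v0 : 0 < v by rewrite sqrtr_gt0 total_weight_gt0.
have uE : u ^+ 2 = A k by rewrite sqr_sqrtr // ltW // total_weight_gt0.
have vE : v ^+ 2 = A k.+1 by rewrite sqr_sqrtr // ltW // total_weight_gt0.
have lE : lam k.+1 = v ^+ 2 - u ^+ 2 by rewrite uE vE AS; ring.
have uv : u <= v by apply: ler_wsqrtr; rewrite AS lerDl ltW.
have h : c * v <= v ^+ 2 - u ^+ 2.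
  rewrite -lE -ler_sqr ?nnegrE ?(ltW (lam_gt0 _)) ?mulr_ge0 ?(ltW v0) //.
  by rewrite lamE -vE exprMn ler_pM2r ?exprn_gt0.
have : c * v <= (v - u) * (2 * v) by nra.
rewrite mulrA ler_pM2r // => h2; lra.
Qed.

Lemma total_weight_ge_quadratic k : (k%:R + 2) ^+ 2 / 4 <= A k.
Proof.
have h : 1 + k%:R / 2 <= Num.sqrt (A k).
  elim: k => [|k IH]; first by rewrite A0 sqrtr1; lra.
  have := sqrt_total_weight_step k 1 ler01.
  rewrite expr1n lerDl mulr_ge0 ?(ltW (total_weight_gt0 _)) // => /(_ isT).
  rewrite -[k.+1%:R]natr1; lra.
have -> : (k%:R + 2) ^+ 2 / 4 = (1 + k%:R / 2 : R) ^+ 2 by field.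
rewrite -[A k]sqr_sqrtr ?(ltW (total_weight_gt0 _)) //.
by rewrite ler_sqr ?nnegrE ?sqrtr_ge0 ?addr_ge0 ?divr_ge0.
Qed.

Lemma total_weight_ge_geometric k : (1 + 2^-1 * Num.sqrt q) ^+ (2 * k) <= A k.
Proof.
have q1 : 0 <= 1 + 2^-1 * Num.sqrt q by rewrite addr_ge0 ?mulr_ge0 ?sqrtr_ge0.
have h : (1 + 2^-1 * Num.sqrt q) ^+ k <= Num.sqrt (A k).
  elim: k => [|k IH]; first by rewrite A0 sqrtr1 expr0.
  have := sqrt_total_weight_step k (Num.sqrt q * Num.sqrt (A k)).
  rewrite mulr_ge0 ?sqrtr_ge0 // exprMn !sqr_sqrtr ?(ltW (total_weight_gt0 _)) //.
  rewrite lerDr ler01 => /(_ isT isT); apply: le_trans.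
  by rewrite exprS; have := ler_wpM2l q1 IH; lra.
rewrite mulnC exprM -[A k]sqr_sqrtr ?(ltW (total_weight_gt0 _)) //.
by rewrite ler_sqr ?nnegrE ?sqrtr_ge0 ?exprn_ge0.
Qed.

Lemma total_weight_ratio k : A k / A k.+1 = 1 - lam k.+1 / A k.+1.
Proof.
have := total_weight_gt0 k.+1 => /gt_eqF/negbT; rewrite AS => h.
by field.
Qed.

(** With s_k = A_k / lam_k, the left side equals s_{k+1}^2 - s_{k+1}, so this compares consecutive
    ratios for every q >= 0. For k > 0 it reduces to A_{k-1} <= A_k, which bounds lam_k^2 by (1 + q
    A_k) A_k. *)
Lemma inverse_step_sqr_ge k : A k / (1 + q * A k) <= (A k / lam k) ^+ 2.
Proof.
have Ak := total_weight_gt0 k.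
have qA i : 0 < 1 + q * A i.
  by have := mulr_ge0 q_ge0 (ltW (total_weight_gt0 i)); lra.
rewrite ler_pdivrMr //; case: k Ak => [|k] Ak.
  by rewrite A0 lam0 divr1 expr1n mul1r mulr1 lerDl.
rewrite expr_div_n lamE mulrAC ler_pdivlMr ?mulr_gt0 //.
rewrite [leRHS]mulrC expr2 !mulrA [leLHS]mulrC !mulrA mulrAC.
rewrite ler_pM2r // [leLHS]mulrC ler_pM2r //.
by rewrite lerD2l ler_wpM2l // AS lerDl ltW.
Qed.

(* For q = 0 the ratios s_k = A_k / lam_k satisfy s_{k+1}^2 - s_{k+1} = s_k^2;
   the majorant T below satisfies T_{k+1}^2 - T_{k+1} >= T_k^2. *)
Lemma inverse_step_le k : A k / lam k <= 1 + k%:R / 2 + 4^-1 * ln (k%:R + 1).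
Proof.
elim: k => [|k IH]; first by rewrite A0 lam0 add0r ln1; lra.
set s := A k / lam k in IH; set s' := A k.+1 / lam k.+1.
set T := 1 + _ + _ in IH; set T' := 1 + _ + _.
have Ak := total_weight_gt0 k; have AkS := total_weight_gt0 k.+1.
have lk := lam_gt0 k.+1.
have qA : 0 < 1 + q * A k by have := mulr_ge0 q_ge0 (ltW Ak); lra.
have s0 : 0 < s by rewrite divr_gt0.
have s'0 : 0 < s' by rewrite divr_gt0.
have rec : s' ^+ 2 - s' <= s ^+ 2.
  have -> : s' ^+ 2 - s' = A k / (1 + q * A k).
    rewrite /s'; have -> : (A k.+1 / lam k.+1) ^+ 2 - A k.+1 / lam k.+1
       = A k.+1 * (A k.+1 - lam k.+1) / lam k.+1 ^+ 2 by field; rewrite gt_eqF.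
    rewrite lamE {2}AS; field; rewrite !gt_eqF //.
  exact: inverse_step_sqr_ge.
have e4 : (k%:R + 2)^-1 / 4 <= T' - T - 2^-1.
  have := @ln_succ_ge R (k%:R + 1).
  rewrite (_ : 0 < k%:R + 1); last by rewrite ltr_wpDl.
  move=> /(_ isT); rewrite (_ : k%:R + 1 + 1 = k%:R + 2); last by lra.
  rewrite /T' /T -[k.+1%:R]natr1 (_ : k%:R + 1 + 1 = k%:R + 2); last by lra.
  by lra.
have T1 : (k%:R + 2) / 2 <= T.
  have := @ln_ge0 R (k%:R + 1); rewrite lerDr ler0n => /(_ isT).
  by rewrite /T; lra.
have k2 : (0 : R) < k%:R + 2 by rewrite ltr_wpDl.
have sT : s ^+ 2 <= T ^+ 2 by rewrite ler_sqr ?nnegrE ?(ltW s0) //; lra.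
(* With e = T' - T - 1/2, (T + e)^2 >= T^2 + 2 T e, where 2 T >= k + 2 and e >= 1 / (4 (k + 2)).
   Completing the square in [rec] then compares s' - 1/2 with T' - 1/2. *)
have key : T ^+ 2 + 4^-1 <= (T' - 2^-1) ^+ 2.
  have e0 : 0 <= T' - T - 2^-1.
    by apply: le_trans e4; rewrite mulr_ge0 ?invr_ge0 ?ltW.
  have : 4^-1 <= (k%:R + 2) * (T' - T - 2^-1).
    apply: le_trans (ler_wpM2l (ltW k2) e4).
    by rewrite mulrA divff ?gt_eqF // mul1r.
  by nra.
have : (s' - 2^-1) ^+ 2 <= (T' - 2^-1) ^+ 2 by lra.
have T'0 : 0 <= T' - 2^-1.
  by have : 0 <= (k%:R + 2 : R)^-1 / 4; [rewrite mulr_ge0 ?invr_ge0 ?ltW|lra].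
case: (lerP s' 2^-1) => [h _|h]; first by lra.
by rewrite ler_sqr ?nnegrE //; lra.
Qed.

Lemma error_ratioS k : error_ratio A k.+1 = 1 + error_ratio A k * (A k / A k.+1).
Proof.
rewrite /error_ratio big_ord_recr /= mulrDl divff ?gt_eqF ?total_weight_gt0 //.
by rewrite addrC; congr (_ + _); field; rewrite !gt_eqF ?total_weight_gt0.
Qed.

Lemma error_ratio0 : error_ratio A 0 = 1.
Proof. by rewrite /error_ratio big_ord_recr big_ord0 /= add0r A0 divr1. Qed.

(** The bound of [inverse_step_le] at k + 1 is exactly 3/2 of the present bound B at k. Hence
    multiplying B by A_k / A_{k+1} = 1 - lam_{k+1} / A_{k+1} lowers it by at least 2/3, and the
    recurrence [error_ratioS] adds 1: a net increase of at most 1/3 per step. *)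
Lemma error_ratio_le_growth k :
  error_ratio A k <= 3^-1 * k%:R + 6^-1 * ln (k%:R + 2) + 1.
Proof.
elim: k => [|k IH].
  rewrite error_ratio0 add0r; have := @ln_ge0 R 2; rewrite ler1n => /(_ isT); lra.
set B := _ + 1 in IH; set B' := _ + 1.
have BB' : B + 3^-1 <= B'.
  have : ln (k%:R + 2) <= ln (k.+1%:R + 2) :> R.
    by rewrite ler_ln ?posrE ?ltr_wpDl // -[k.+1%:R]natr1; lra.
  by rewrite /B' /B -[k.+1%:R]natr1; lra.
have Ak := total_weight_gt0 k; have AkS := total_weight_gt0 k.+1.
have lk := lam_gt0 k.+1.
have sT := inverse_step_le k.+1.
have {}sT : A k.+1 / lam k.+1 <= 3 / 2 * B.
  apply: le_trans sT _; rewrite -[k.+1%:R]natr1 /B.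
  rewrite (_ : k%:R + 1 + 1 = k%:R + 2); lra.
rewrite error_ratioS; apply: le_trans BB'.
have r0 : 0 <= A k / A k.+1 by rewrite divr_ge0 ?ltW.
have : B * (A k / A k.+1) <= B - 2 / 3.
  rewrite total_weight_ratio mulrBr mulr1 lerD2l lerN2.
  move: sT; rewrite ler_pdivrMr // mulrA ler_pdivlMr // => sT; lra.
have := ler_wpM2r r0 IH; lra.
Qed.

(** The bound is the fixed point of r -> 1 + r / (1 + sqrt q), and lam_{k+1} >= sqrt q A_k gives A_k
    / A_{k+1} <= 1 / (1 + sqrt q). *)
Lemma error_ratio_le_const k : 0 < q -> error_ratio A k <= 1 + (Num.sqrt q)^-1.
Proof.
move=> q0; have p0 : 0 < Num.sqrt q by rewrite sqrtr_gt0.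
set p := Num.sqrt q in p0 *.
elim: k => [|k IH]; first by rewrite error_ratio0 lerDl invr_ge0 ltW.
have Ak := total_weight_gt0 k; have AkS := total_weight_gt0 k.+1.
have lk := lam_gt0 k.+1.
have AA : A k <= A k.+1 by rewrite AS lerDl ltW.
have pl : p * A k <= lam k.+1.
  rewrite -ler_sqr ?nnegrE ?(ltW lk) ?mulr_ge0 ?(ltW p0) ?(ltW Ak) //.
  rewrite lamE exprMn sqr_sqrtr // expr2 mulrA.

  by apply: ler_pM => //; rewrite ?mulr_ge0 ?(ltW Ak) // lerDr.
have r0 : 0 <= A k / A k.+1 by rewrite divr_ge0 ?ltW.
rewrite error_ratioS lerD2l; apply: le_trans (ler_wpM2r r0 IH) _.
rewrite mulrA ler_pdivrMr // AS.
have -> : (1 + p^-1) * A k = p^-1 * (A k + p * A k) by field; rewrite gt_eqF.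
by rewrite ler_pM2l ?invr_gt0 // lerD2l.
Qed.

End StepSizes.

(** * Convexity over Q and the lower bound on the Bregman distance *)

Lemma convex_set_mem {R : realType} {E : normedModType R} {Q : set E} :
  convex_set Q -> forall x y (t : R), Q x -> Q y -> 0 <= t <= 1 ->
  Q (t *: x + (1 - t) *: y).
Proof.
move=> cQ x y t Qx Qy /andP[t0 t1].
have := cQ x y (Itv01 t0 t1); rewrite !in_setE; exact.
Qed.

Lemma convex_on_fine {R : realType} {E : normedModType R} {A : set E}
    {g : E -> \bar R} {x y : E} {t : R} :
  convex_on A g -> A x -> A y -> 0 <= t <= 1 ->
  g x \is a fin_num -> g y \is a fin_num ->
  g (t *: x + (1 - t) *: y) \is a fin_num ->
  fine (g (t *: x + (1 - t) *: y)) <= t * fine (g x) + (1 - t) * fine (g y).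
Proof.
move=> cg Ax Ay t01 gx gy gxy; have := cg x y t Ax Ay t01.
by rewrite -(fineK gx) -(fineK gy) -(fineK gxy) -!EFinM -EFinD lee_fin.
Qed.

Section Prox.
Context {R : realType} {E : normedModType R}.
Context {Q : set E} {d : E -> \bar R} {gd : E -> {scalar E}}.
Context {sd : R} {x0 : E}.
Hypotheses (Q_convex : convex_set Q) (d_prox : prox_function Q d gd sd x0).

Lemma prox_fin_num x : Q x -> d x \is a fin_num.
Proof.
by move=> Qx; rewrite fin_numElt (prox_ninfty d_prox) (prox_dom d_prox Qx).
Qed.

(** Strong convexity on the segment from y to x, divided by the parameter t, as t -> 0. The limit is
    replaced by a single small t whose total error is at most an arbitrary e > 0. *)
Lemma bregman_ge x y : Q x -> Q y ->
  sd / 2 * `|x - y| ^+ 2 <= bregman d gd y x.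
Proof.
move=> Qx Qy; set n := `|x - y|; rewrite /bregman /linearization.
set D := fine (d x); set D0 := fine (d y); set G := gd y (x - y).
have n0 : 0 <= n by rewrite normr_ge0.
have sd0 := prox_sd_gt0 d_prox.
apply/ler_addgt0Pr => e e0.
(* Half of e pays for the gradient remainder, the other half for the term in sd t n^2; n + 1 keeps
   the denominator positive when x = y. *)
set eps := e / (2 * (n + 1)).
have eps0 : 0 < eps by rewrite divr_gt0 // mulr_gt0 //; lra.
have epsn : eps * n <= e / 2.
  rewrite /eps -mulrA ler_pM2l // ler_pdivrMl ?mulr_gt0 //; last by lra.
  by lra.
have /nbhs_normP[r /= r0 hr] := prox_gradient d_prox Qy eps0.
have [t [t0 t1 tr te]] : exists t : R,
    [/\ 0 < t, t <= 1, t * n < r & sd * t * n ^+ 2 <= e].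
  have n1 : 0 < n + 1 by lra.
  have m1 : 0 < sd * (n ^+ 2 + 1) by rewrite mulr_gt0 // ltr_wpDl // sqr_ge0.
  (* The three entries keep the point on the segment, put it in the ball where the gradient estimate
     holds, and bound the second-order term in t. *)
  exists (Num.min 1 (Num.min (r / (n + 1)) (e / (sd * (n ^+ 2 + 1))))).
  set t := Num.min _ _.
  have [t1 tr te] : [/\ t <= 1, t <= r / (n + 1) & t <= e / (sd * (n ^+ 2 + 1))].
    by rewrite /t !ge_min !lexx !orbT.
  have t0 : 0 < t by rewrite !lt_min ltr01 !divr_gt0.
  split=> //; first by move: tr; rewrite ler_pdivlMr //; nra.
  by move: te; rewrite ler_pdivlMr //; nra.
have t01 : 0 <= t <= 1 by rewrite (ltW t0).
set p := t *: x + (1 - t) *: y.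
have Qp : Q p by exact: convex_set_mem.
have py : p - y = t *: (x - y).
  by rewrite /p scalerBl scale1r scalerBr addrA addrAC addrK.
have pn : `|p - y| = t * n by rewrite py normrZ gtr0_norm.
have := prox_strongly_convex d_prox Qx Qy t01; rewrite -/p -/n.
rewrite -(fineK (prox_fin_num _ Qp)) -(fineK (prox_fin_num _ Qx)).
rewrite -(fineK (prox_fin_num _ Qy)) -!EFinM -EFinD lee_fin -/D -/D0 => sc.
have /= := hr p; rewrite distrC pn => /(_ tr Qp).
rewrite py linearZ /= -/G -/D0 ler_norml => /andP[lb _].
set dp := fine (d p) in sc lb; rewrite -(ler_pM2l t0).
have h1 := ler_wpM2l (ltW t0) epsn.
have h2 := ler_wpM2l (ltW t0) te.
have -> : t * (D - (D0 + G) + e) = t * D - t * D0 - t * G + t * e by ring.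
move: sc lb h1 h2.
have -> : sd / 2 * (t * (1 - t)) * n ^+ 2 =
  t * (sd / 2 * n ^+ 2) - t * (sd * t * n ^+ 2) / 2 by field.
have -> : eps * (t * n) = t * (eps * n) by ring.
rewrite mulrBl mul1r; set a := t * (sd * t * _).
rewrite /GRing.scale /= => sc lb h1 h2; lra.
Qed.

Lemma bregman_ge0 x y : Q x -> Q y -> 0 <= bregman d gd y x.
Proof.
move=> Qx Qy; apply: le_trans (bregman_ge _ _ Qx Qy).
by rewrite mulr_ge0 ?sqr_ge0 // divr_ge0 // (ltW (prox_sd_gt0 d_prox)).
Qed.

End Prox.

(** * Recurrence for the minima of psi along the method *)

Section Recurrence.
Context {R : realType} {E : normedModType R}.
Context {Q : set E} {d : E -> \bar R} {gd : E -> {scalar E}}.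
Context {sd : R} {x0 : E}.
Hypotheses (Q_convex : convex_set Q) (d_prox : prox_function Q d gd sd x0).
Context {f : E -> \bar R} {mf : E -> E -> \bar R} {sf sbar L delta : R}.
Hypothesis fSP :
  structured_problem Q d gd f mf sf sbar (fun=> L) (fun _ _ => delta).
Context {lam beta : nat -> R} {phi psi : nat -> E -> \bar R}.
Context {z w x xh : nat -> E}.
Hypothesis mm : modified_method Q d gd mf sf x0 lam beta phi psi z w x xh.

Local Notation S := (psum lam).
Local Notation F y := (fine (f y)).
Local Notation m j y := (fine (mf (x j) y)).

Lemma objective_fin_num y : Q y -> f y \is a fin_num.
Proof.
by move=> Qy; rewrite fin_numElt (sp_f_ninfty fSP) (sp_f_dom fSP Qy).
Qed.

Lemma model_fin_num y u : Q y -> Q u -> mf y u \is a fin_num.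
Proof.
move=> Qy Qu; rewrite fin_numElt (sp_m_ninfty fSP) //=.
exact: le_lt_trans (sp_m_le fSP Qy Qu) (sp_f_dom fSP Qu).
Qed.

Lemma model_le y u : Q y -> Q u -> fine (mf y u) <= fine (f u).
Proof.
move=> Qy Qu; apply: fine_le (sp_m_le fSP Qy Qu).
  exact: model_fin_num.
exact: objective_fin_num.
Qed.

Lemma psumS j : S j.+1 = S j + lam j.
Proof. by rewrite /psum big_ord_recr. Qed.

Lemma psum_ge0 j : 0 <= S j.
Proof.
by apply: sumr_ge0 => i _; rewrite ltW // (lam_gt0 (mm_parameters mm)).
Qed.

Lemma psumS_gt0 j : 0 < S j.+1.
Proof. by rewrite psumS ltr_wpDl ?psum_ge0 // (lam_gt0 (mm_parameters mm)). Qed.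

Lemma z_mem j : Q (z j).
Proof. by have [] := cs_z (mm_coupled_sequence mm) j. Qed.

Lemma w_mem j : Q (w j).
Proof. by have [] := cs_w (mm_coupled_sequence mm) j. Qed.

(* hat x_{j-1}, extended to j = 0 so that the first step is an instance of the
   general one, with weight S_{-1} = 0. *)
Definition averages j : E := if j is i.+1 then xh i else x0.

Local Notation v := averages.
Local Notation t j := (S j / S j.+1).

Lemma weight_itv j : 0 <= t j <= 1.
Proof.
rewrite divr_ge0 ?psum_ge0 //= ler_pdivrMr ?psumS_gt0 // mul1r psumS lerDl.
by rewrite ltW // (lam_gt0 (mm_parameters mm)).
Qed.

Lemma weight_compl j : 1 - t j = lam j / S j.+1.
Proof.
have /gt_eqF/negbT := psumS_gt0 j; rewrite psumS => h; by field.
Qed.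

Lemma averagesS j : v j.+1 = t j *: v j + (1 - t j) *: w j.+1.
Proof.
case: j => [|j] /=; last first.
  by rewrite (mm_xh mm) scalerDr !scalerA weight_compl ![_^-1 * _]mulrC.
by rewrite (mm_xh0 mm) /psum big_ord0 mul0r scale0r add0r subr0 scale1r.
Qed.

Lemma test_pointE j : x j = t j *: v j + (1 - t j) *: z j.
Proof.
case: j => [|j] /=; last first.
  by rewrite (mm_x mm) scalerDr !scalerA weight_compl ![_^-1 * _]mulrC.
rewrite (mm_x0 mm) (cs_B1_z (mm_coupled_sequence mm)).
by rewrite /psum big_ord0 mul0r scale0r add0r subr0 scale1r.
Qed.

Lemma averages_mem j : Q (v j).
Proof.
elim: j => [|j IH] /=.
  by rewrite -(cs_B1_z (mm_coupled_sequence mm)); exact: z_mem.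
rewrite -/(v j.+1) averagesS; apply: (convex_set_mem Q_convex) => //.
- exact: w_mem.
- exact: weight_itv.
Qed.

Lemma test_point_mem j : Q (x j).
Proof.
rewrite test_pointE; apply: (convex_set_mem Q_convex).
- exact: averages_mem.
- exact: z_mem.
- exact: weight_itv.
Qed.

Lemma psi_min_le j y : Q y ->
  (psi j (w j) <= (\sum_(i < j) lam i * m i y
     + beta j * linearization d gd (z j) y
     - S j * sf * bregman d gd (z j) y)%:E)%E.
Proof.
move=> Qy; apply: le_trans (cs_B3 (mm_coupled_sequence mm) j) _.
apply: ereal_inf_lbound; exists y => //.
rewrite EFinB EFinD -sumEFin; congr (_ + _ - _)%E.
apply: eq_bigr => i _; rewrite EFinM fineK //.
by apply: model_fin_num => //; exact: test_point_mem.
Qed.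

(** (B3) at a point of Q, here [z j], excludes +oo, so the recurrence can be run in the reals. *)
Lemma psi_min_fin_num j : psi j (w j) \is a fin_num.
Proof.
rewrite fin_numElt (cs_psi_ninfty (mm_coupled_sequence mm)) /=.
exact: le_lt_trans (psi_min_le j _ (z_mem j)) (ltry _).
Qed.

Local Notation P j := (fine (psi j (w j))).

(** (B2) at [w j.+1], with phi_j(z_j) replaced by a lower bound: minimality of [w j] and (B0) give
    psi_j(w_j) <= psi_j(z_j) <= phi_j(z_j). *)
Lemma psi_min_step j :
  P j + lam j * m j (w j.+1) + beta j.+1 * fine (d (w j.+1))
    - beta j * linearization d gd (z j) (w j.+1)
    + S j * sf * bregman d gd (z j) (w j.+1) <= P j.+1.
Proof.
have Qw := w_mem j.+1; have cs := mm_coupled_sequence mm.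
have [_ w_min] := cs_w cs j.
have phi_ge : (psi j (w j) <= phi j (z j))%E.
  exact: le_trans (w_min _ (z_mem j)) (cs_B0 cs _ (z_mem j)).
rewrite -lee_fin (fineK (psi_min_fin_num _)).
apply: le_trans (cs_B2 cs j Qw).
rewrite !(EFinD, EFinB) !EFinM (fineK (psi_min_fin_num _)) !fineK.
- by rewrite !leeD2r.
- exact: prox_fin_num d_prox _ Qw.
- by apply: model_fin_num => //; exact: test_point_mem.
Qed.

(** Left general in [beta] so that both step-size rules share it: the coefficient of the squared
    norm vanishes for the accelerated weights and is L/2 times [lam j ^+ 2 / S j.+1] for the
    conditional gradient ones. *)
Definition step_error j : R := S j.+1 * delta
  + ((L - sbar * sd) * (lam j ^+ 2 / S j.+1) - sd * (beta j + S j * sf)) / 2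
    * `|w j.+1 - z j| ^+ 2.

(** The Bregman term of the upper model, bounded by [bregman_ge], lowers L to L - sbar sd. The
    points v_{j+1} and x_j differ by (1 - t_j)(w_{j+1} - z_j), since both put weight t_j on v_j. *)
Lemma upper_model j :
  F (v j.+1) <= m j (v j.+1)
    + (L - sbar * sd) / 2 * ((1 - t j) * `|w j.+1 - z j|) ^+ 2 + delta.
Proof.
have Qx := test_point_mem j; have Qv := averages_mem j.+1.
have := sp_upper fSP Qv Qx.
rewrite -(fineK (objective_fin_num _ Qv)) -(fineK (model_fin_num _ _ Qx Qv)).
rewrite -EFinB -!EFinD lee_fin => up; apply: le_trans up _.
have vx : v j.+1 - x j = (1 - t j) *: (w j.+1 - z j).
  by rewrite averagesS test_pointE scalerBr opprD addrACA subrr add0r.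
have := bregman_ge Q_convex d_prox _ _ Qv Qx.
rewrite [`|x j - _|]distrC vx normrZ ger0_norm; last first.
  by have /andP[_] := weight_itv j; rewrite subr_ge0.
have /andP[sbar0 _] := sp_sbar fSP => /(ler_wpM2l sbar0).
set n := (_ * `|_|) ^+ 2; lra.
Qed.

Lemma averages_estimate j :
  S j * F (v j) <= P j + \sum_(i < j) step_error i.
Proof.
elim: j => [|j IH].
  rewrite /psum !big_ord0 mul0r (cs_B1_psi (mm_coupled_sequence mm)) /=; lra.
have Sj := psum_ge0 j; have Sj1 := psumS_gt0 j.
have lj := lam_gt0 (mm_parameters mm) j.
have Qx := test_point_mem j; have Qv := averages_mem j.
have Qw := w_mem j.+1; have Qz := z_mem j.
have m_le : S j * m j (v j) <= S j * F (v j) by rewrite ler_wpM2l // model_le.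
have m_conv : S j.+1 * m j (v j.+1) <= S j * m j (v j) + lam j * m j (w j.+1).
  have := convex_on_fine (sp_m_convex fSP Qx) I I (weight_itv j)
    (model_fin_num _ _ Qx Qv) (model_fin_num _ _ Qx Qw).
  rewrite -averagesS => /(_ (model_fin_num _ _ Qx (averages_mem _))).
  rewrite -(ler_pM2l Sj1) weight_compl => /le_trans; apply.
  by rewrite le_eqVlt; apply/orP; left; apply/eqP; field; rewrite gt_eqF.
(* (B2) supplies [beta j.+1] times d, whereas the Bregman distance with factor [beta j] takes up
   only [beta j] times d; the surplus is nonnegative. *)
have prox_incr : beta j * fine (d (w j.+1)) <= beta j.+1 * fine (d (w j.+1)).
  apply: ler_wpM2r; first exact: fine_ge0 (prox_ge0 d_prox Qw).
  exact: beta_nondecreasing (mm_parameters mm) _ _ (leqnSn j).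
have breg : (beta j + S j * sf) * (sd / 2 * `|w j.+1 - z j| ^+ 2) <=
    (beta j + S j * sf) * bregman d gd (z j) (w j.+1).
  apply: ler_wpM2l; last exact: (bregman_ge Q_convex d_prox).
  by rewrite addr_ge0 ?mulr_ge0 ?(beta_ge0 (mm_parameters mm)) ?(sp_sf_ge0 fSP).
have := ler_wpM2l (ltW Sj1) (upper_model j).
rewrite weight_compl !mulrDr => up.
have quad : S j.+1 * ((L - sbar * sd) / 2 * (lam j / S j.+1 * `|w j.+1 - z j|) ^+ 2)
    = (L - sbar * sd) * (lam j ^+ 2 / S j.+1) / 2 * `|w j.+1 - z j| ^+ 2.
  by field; rewrite gt_eqF.
rewrite quad in up.
have := psi_min_step j; rewrite /bregman in breg *.
rewrite big_ord_recr /= /step_error.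
move: IH m_le m_conv prox_incr breg up.
set n2 := `|_| ^+ 2.
set a := _ / S j.+1.
set l := linearization _ _ _ _.
lra.
Qed.

Lemma objective_estimate k y : Q y ->
  S k.+1 * (F (xh k) - F y + sf * bregman d gd (z k.+1) y) <=
  beta k.+1 * linearization d gd (z k.+1) y + \sum_(i < k.+1) step_error i.
Proof.
move=> Qy; have := averages_estimate k.+1 => /=.
have := psi_min_le k.+1 y Qy.
rewrite -(fineK (psi_min_fin_num _)) lee_fin.
have : \sum_(i < k.+1) lam i * m i y <= S k.+1 * F y.
  rewrite /psum mulr_suml; apply: ler_sum => i _.
  apply: ler_wpM2l; first by rewrite ltW // (lam_gt0 (mm_parameters mm)).
  exact: model_le (test_point_mem _) Qy.
lra.
Qed.

End Recurrence.

(** * Sums for the conditional gradient weights *)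

Lemma sum_ratio_le {R : realType} (k : nat) :
  \sum_(i < k.+1) (i.+1%:R / i.+2%:R : R) <= k.+1%:R * k.+2%:R / (k%:R + 4).
Proof.
elim: k => [|k IH]; first by rewrite big_ord_recr big_ord0 /= !add0r; lra.
rewrite big_ord_recr /=; apply: le_trans (lerD IH (lexx _)) _.
have k0 : 0 <= k%:R :> R by [].
rewrite -![k.+3%:R]natr1 -![k.+2%:R]natr1 -![k.+1%:R]natr1.
set n := k%:R in k0 *; rewrite -subr_ge0.
have -> : (n + 1 + 1) * (n + 1 + 1 + 1) / (n + 1 + 4) -
   ((n + 1) * (n + 1 + 1) / (n + 4) + (n + 1 + 1) / (n + 1 + 1 + 1))
   = (n + 2) * (n + 1) / ((n + 3) * (n + 4) * (n + 5)).
  by field; rewrite !gt_eqF //; lra.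
by rewrite divr_ge0 ?mulr_ge0 //; lra.
Qed.

Section HalfIntegerWeights.
Context {R : realType} {lam : nat -> R}.
Hypothesis lamE : forall k, lam k = k.+1%:R / 2.

Lemma half_psum j : psum lam j = j%:R * j.+1%:R / 4.
Proof.
elim: j => [|j IH]; first by rewrite /psum big_ord0 !mul0r.
by rewrite psumS IH lamE -[j.+2%:R]natr1 -[j.+1%:R]natr1; field.
Qed.

Lemma half_sum_psum k :
  \sum_(i < k.+1) psum lam i.+1 = k.+1%:R * k.+2%:R * (k%:R + 3) / 12.
Proof.
elim: k => [|k IH]; first by rewrite big_ord_recr big_ord0 /= half_psum; field.
rewrite big_ord_recr /= IH half_psum -![k.+3%:R]natr1 -![k.+2%:R]natr1.
by rewrite -![k.+1%:R]natr1; field.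
Qed.

Lemma half_step_ratio j : lam j ^+ 2 / psum lam j.+1 = j.+1%:R / j.+2%:R.
Proof.
have j0 : 0 <= j%:R :> R by [].
rewrite half_psum lamE -[j.+2%:R]natr1 -[j.+1%:R]natr1.
by field; rewrite !gt_eqF //; lra.
Qed.

End HalfIntegerWeights.

(** * Rates for the weights defined by the largest root *)

Section AcceleratedRates.
Context {R : realType}.
Context {M sf sd : R} {lam : nat -> R}.
Hypotheses (M_ge0 : 0 <= M) (sf_ge0 : 0 <= sf) (sd_gt0 : 0 < sd).
Hypotheses (lam_gt0 : forall k, 0 < lam k) (lam0 : lam 0%N = 1).
Hypothesis lam_root : forall k, largest_root
  (fun mu => M * mu ^+ 2 =
     sd * (psum lam k.+1 * sf + M / sd) * (mu + psum lam k.+1)) (lam k.+1).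

Local Notation A k := (psum lam k.+1).
Local Notation q := (sf * sd / M).

Lemma psum1 : A 0 = 1.
Proof. by rewrite /psum big_ord_recr big_ord0 /= add0r. Qed.

(* For M = 0 the equation has no positive largest root. *)
Lemma curvature_gt0 : 0 < M.
Proof.
rewrite lt_def M_ge0 andbT; apply/eqP => M0.
have [/esym] := lam_root 0; rewrite M0 psum1 !mul0r mul1r addr0.
move=> /eqP; rewrite !mulf_eq0 (gt_eqF sd_gt0) /= orbC gt_eqF ?addr_gt0 //=.
(* For M = 0 the equation at [lam 1] forces sf = 0; then every real is a root, so none is
   largest. *)
move=> /eqP sf0 /(_ (lam 1%N + 1)).
by rewrite sf0 !(mul0r, mulr0) => /(_ erefl); lra.
Qed.

Lemma step_size_sqr k : lam k.+1 ^+ 2 = (1 + q * A k) * A k.+1.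
Proof.
have M0 := lt0r_neq0 curvature_gt0; have sd0 := lt0r_neq0 sd_gt0.
apply: (mulfI M0); rewrite (lam_root k).1 [psum lam k.+2]psumS.
by field; rewrite M0 sd0.
Qed.

Let q_ge0 : 0 <= q.
Proof. by rewrite divr_ge0 ?mulr_ge0 ?(ltW sd_gt0). Qed.

Let A_succ k : A k.+1 = A k + lam k.+1.
Proof. exact: psumS. Qed.

Let A_gt0 k : 0 < A k.
Proof. exact: (total_weight_gt0 (A := fun k => A k)) lam_gt0 psum1 A_succ k. Qed.

Lemma inv_total_weight_le_rate k : (A k)^-1 <= rate M sf sd k.
Proof.
rewrite /rate le_min; apply/andP; split.
  have r0 : 0 < (k%:R + 2) ^+ 2 / 4 :> R.
    by rewrite divr_gt0 // exprn_gt0 // ltr_wpDl.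
  rewrite -invf_div lef_pV2 ?posrE //.
  exact: (total_weight_ge_quadratic (A := fun k => A k) q_ge0 lam_gt0 psum1
    A_succ step_size_sqr).
have r0 : 0 < 1 + 2^-1 * Num.sqrt q.
  by rewrite ltr_wpDr // mulr_ge0 ?sqrtr_ge0 ?invr_ge0.
rewrite lef_pV2 ?posrE ?exprn_gt0 //.
exact: (total_weight_ge_geometric (A := fun k => A k) q_ge0 lam_gt0 psum1
  A_succ step_size_sqr).
Qed.

Lemma error_ratio_le_factor k :
  error_ratio (fun k => A k) k <= error_factor M sf sd k.
Proof.
rewrite /error_factor; have growth := error_ratio_le_growth q_ge0 lam_gt0
  lam0 (A := fun k => A k) psum1 A_succ step_size_sqr k.
case: (eqVneq sf 0) => [//|sf_neq0]; rewrite le_min growth /=.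
have q_gt0 : 0 < q.
  by rewrite divr_gt0 ?curvature_gt0 // mulr_gt0 // lt0r sf_neq0.
rewrite -[M / _]invf_div sqrtrV //.
exact: (error_ratio_le_const (A := fun k => A k) q_ge0 lam_gt0 psum1
  A_succ step_size_sqr).
Qed.

(** This removes the quadratic part of [step_error]. For j > 0 it is the root equation; for j = 0,
    where S_{-1} = 0, it holds because beta = M / sd and lam_0 = S_0 = 1. *)
Lemma quadratic_term_eq0 j :
  M * (lam j ^+ 2 / psum lam j.+1) - sd * (M / sd + psum lam j * sf) = 0.
Proof.
have sd0 := lt0r_neq0 sd_gt0; have M0 := lt0r_neq0 curvature_gt0.
case: j => [|j].
  by rewrite psum1 lam0 /psum big_ord0; field.
have A0 := lt0r_neq0 (A_gt0 j.+1).
by rewrite step_size_sqr; field; rewrite sd0 M0 A0.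
Qed.

End AcceleratedRates.

(** * Both bounds from the common estimate *)

Theorem theorem5p3 (R : realType) (E : normedModType R)
  (E_findim : finite_dimensional E)
  (Q : set E) (Q_closed : closed Q) (Q_convex : convex_set Q)
  (d : E -> \bar R) (gd : E -> {scalar E}) (sd : R) (x0 : E)
  (d_prox : prox_function Q d gd sd x0)
  (f : E -> \bar R) (mf : E -> E -> \bar R) (sf sbar L delta : R)
  (L_ge0 : 0 <= L) (delta_ge0 : 0 <= delta)
  (fSP : structured_problem Q d gd f mf sf sbar (fun=> L) (fun _ _ => delta))
  (L_ge : sbar * sd <= L)
  (xs : E) (xs_opt : argmin Q f xs) :
  (forall (lam : nat -> R) (phi psi : nat -> E -> \bar R)
          (z w x xh : nat -> E),
     let M := L - sbar * sd in
     let beta : nat -> R := fun=> M / sd in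
     modified_method Q d gd mf sf x0 lam beta phi psi z w x xh ->
     lam 0%N = 1 ->
     (forall k, largest_root
        (fun mu => M * mu ^+ 2 =
                   sd * (psum lam k.+1 * sf + beta k) * (mu + psum lam k.+1))
        (lam k.+1)) ->
     forall k : nat,
     (* The printed inequality is [bound l].  It can fail when [l < 0] and
        [delta > 0]; in that case it is stated with [l] replaced by 0. *)
     let l := linearization d gd (z k.+1) xs in
     let bound (t : R) : Prop :=
       (f (xh k) - f xs + (sf * bregman d gd (z k.+1) xs)%:E <=
        (M / sd * t * rate M sf sd k + error_factor M sf sd k * delta)%:E)%E in
     (0 <= l \/ delta = 0 -> bound l) /\ bound (Num.max l 0))
  /\
  (sf = 0 -> bounded_set Q ->
   forall (lam : nat -> R) (phi psi : nat -> E -> \bar R)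
          (z w x xh : nat -> E),
     modified_method Q d gd mf sf x0 lam (fun=> 0) phi psi z w x xh ->
     (forall k, lam k = k.+1%:R / 2) ->
     forall k : nat,
       (f (xh k) - f xs <=
        (2 * L * (\big[Num.max/0]_(i < k.+1) `|w i.+1 - z i| ^+ 2)
           / (k%:R + 4)
         + (k%:R + 3) / 3 * delta)%:E)%E).
Proof.
have sd_gt0 := prox_sd_gt0 d_prox; have sf_ge0 := sp_sf_ge0 fSP.
have [Qxs xs_min] := xs_opt.
split.
- move=> lam phi psi z w x xh M beta mm lam0 lam_root k l bound.
  have lam_gt0' := lam_gt0 (mm_parameters mm).
  have M_ge0 : 0 <= M by rewrite subr_ge0.
  have M_gt0 := curvature_gt0 M_ge0 sd_gt0 lam_gt0' lam0 lam_root.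
  have Qxh : Q (xh k) := averages_mem Q_convex mm k.+1.
  have est := objective_estimate Q_convex d_prox fSP mm k xs Qxs.
  set A := psum lam k.+1 in est.
  have A_gt0 : 0 < A := psumS_gt0 mm k.
  set X := (X in A * X <= _) in est.
  (* After division by S_k, each step error contributes only its part S_i delta, and these add up to
     the error ratio. *)
  have {}est : X <= M / sd * l * A^-1
      + error_ratio (fun i => psum lam i.+1) k * delta.
    move: est; rewrite -ler_pdivlMl // => /le_trans; apply.
    rewrite mulrC mulrDl lerD2l /error_ratio -/A [leRHS]mulrAC.
    rewrite ler_pM2r ?invr_gt0 // mulr_suml; apply: ler_sum => i _.
    rewrite /step_error (quadratic_term_eq0 M_ge0 sd_gt0 lam_gt0' lam0 lam_root).
    by rewrite !mul0r addr0.
  (* Replacing 1 / S_k by the larger [rate] requires a nonnegative factor, so l is first raised to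
     some t >= 0. *)
  have boundW t : 0 <= t -> l <= t -> bound t.
    move=> t0 lt; rewrite /bound -(fineK (objective_fin_num fSP _ Qxh)).
    rewrite -(fineK (objective_fin_num fSP _ Qxs)) -EFinB -EFinD lee_fin.
    apply: le_trans est (lerD _ _); last first.
      apply: ler_wpM2r => //.
      exact: error_ratio_le_factor M_ge0 sf_ge0 sd_gt0 lam_gt0' lam0 lam_root k.
    have c0 : 0 <= M / sd by rewrite divr_ge0 ?ltW.
    apply: (@le_trans _ _ (M / sd * t * A^-1)).
      by rewrite ler_pM2r ?invr_gt0 // ler_wpM2l.
    apply: ler_wpM2l; first exact: mulr_ge0.
    exact: inv_total_weight_le_rate M_ge0 sf_ge0 sd_gt0 lam_gt0' lam0 lam_root k.
  split=> [[l0|delta0]|]; first exact: boundW.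
    apply: boundW => //.
    (* l < 0 is impossible: the left-hand side X of the bound is nonnegative. *)
    have X0 : 0 <= X.
      rewrite addr_ge0 //.
        rewrite subr_ge0; apply: fine_le (xs_min _ Qxh).
          exact: objective_fin_num fSP _ Qxs.
        exact: objective_fin_num fSP _ Qxh.
      by rewrite mulr_ge0 // (bregman_ge0 Q_convex d_prox) //; exact: z_mem mm _.
    move: (le_trans X0 est); rewrite delta0 mulr0 addr0.
    by rewrite pmulr_lge0 ?invr_gt0 // pmulr_rge0 // divr_gt0.
  by apply: boundW; rewrite le_max lexx ?orbT.
- move=> sf0 _ lam phi psi z w x xh mm lamE k.
  have Qxh : Q (xh k) := averages_mem Q_convex mm k.+1.
  have est := objective_estimate Q_convex d_prox fSP mm k xs Qxs.
  have sbar0 : sbar = 0.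
    by apply/le_anti; have := sp_sbar fSP; rewrite sf0 andbC.
  rewrite -(fineK (objective_fin_num fSP _ Qxh)).
  rewrite -(fineK (objective_fin_num fSP _ Qxs)) -EFinB lee_fin.
  move: est; rewrite !sf0 !mul0r addr0 add0r.
  set X := fine _ - fine _; set T := (\sum_(i < _) step_error _).
  set D := \big[_/_]_(i < _) _.
  (* With beta = sf = sbar = 0 nothing offsets the quadratic term, so each squared step is bounded
     by the maximum D. *)
  have err : T <=
      delta * (\sum_(i < k.+1) psum lam i.+1)
      + L * D / 2 * (\sum_(i < k.+1) i.+1%:R / i.+2%:R).
    rewrite /T !mulr_sumr -big_split /=; apply: ler_sum => i _.
    rewrite /step_error sbar0 mul0r subr0 add0r !mulr0 subr0.
    rewrite half_step_ratio // [_ * delta]mulrC lerD2l.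
    set r := _ / _.
    have -> : L * D / 2 * r = L * r / 2 * D by ring.
    apply: ler_wpM2l; first by rewrite !mulr_ge0 // divr_ge0.
    exact: (le_bigmax 0 (fun i : 'I_k.+1 => `|w i.+1 - z i| ^+ 2) i).
  have D0 : 0 <= D.
    exact: le_trans (sqr_ge0 _)
      (le_bigmax 0 (fun i : 'I_k.+1 => `|w i.+1 - z i| ^+ 2) ord0).
  move=> /le_trans/(_ err) est.
  have LD0 : 0 <= L * D / 2 by rewrite divr_ge0 ?mulr_ge0.
  (* The bound of [sum_ratio_le] is 4 S_k / (k + 4) and the sum in [half_sum_psum] is S_k (k + 3) /
     3, so division by S_k leaves an identity. *)
  have := le_trans est (lerD (lexx _) (ler_wpM2l LD0 (sum_ratio_le k))).
  rewrite half_sum_psum // half_psum //.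
  have c0 : 0 < k.+1%:R * k.+2%:R / 4 :> R by [].
  rewrite -ler_pdivlMl // => /le_trans; apply.
  rewrite le_eqVlt; apply/orP; left; apply/eqP.
  have k0 : 0 <= k%:R :> R by [].
  rewrite -![k.+2%:R]natr1 -![k.+1%:R]natr1.
  by field; rewrite !gt_eqF //; lra.
Qed.
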